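(* Let $n\ge 1$. Given simple graphs $G$ and $H$ on the vertex set $\{1,\ldots,n\}$, a positive definite diagonal matrix $M\in\mathbb{R}^{n\times n}$, and $2n$ distinct real numbers $\lambda_1,\lambda_2,\ldots,\lambda_{2n}$, there are real symmetric $n\times n$ matrices $D$ and $K$ whose graphs are $G$ and $H$, respectively, such that the quadratic matrix polynomial $L(z)=Mz^2+Dz+K$ has proper values $\lambda_1,\lambda_2,\ldots,\lambda_{2n}$.
   Context: A proper value of a matrix polynomial $L(z)$ is a zero $z\in\mathbb{C}$ of $\det L(z)$. Graphs are simple (undirected, loopless, without multiple edges). The graph of a real symmetric matrix $B=[b_{ij}]\in\mathbb{R}^{n\times n}$ is the simple graph on vertices $1,\ldots,n$ in which distinct vertices $i\ne j$ are adjacent if and only if $b_{ij}\neq 0$; the diagonal entries play no role. *)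

(* Defs.v *)
From mathcomp Require Import all_boot all_order all_algebra.
From mathcomp Require Import reals complex.

Set Implicit Arguments.
Unset Strict Implicit.
Unset Printing Implicit Defensive.

Import GRing.Theory Num.Theory.
Local Open Scope ring_scope.

Definition simple_graph (T : finType) (e : rel T) : Prop :=
  symmetric e /\ irreflexive e.

(* Diagonal entries are ignored; the result is a simple graph when B is
   symmetric. *)
Definition mx_graph (R : nzRingType) (n : nat) (B : 'M[R]_n) : rel 'I_n :=
  fun i j => (i != j) && (B i j != 0).

Definition posdefmx (R : realFieldType) (n : nat) (A : 'M[R]_n) : Prop :=
  A \is symmetricmx /\
  forall x : 'cV[R]_n, x != 0 -> 0 < (x^T *m A *m x) 0 0.

(* A matrix polynomial is encoded as a matrix with polynomial entries. *)
Definition quadratic_mxpoly (R : nzRingType) (n : nat) (M D K : 'M[R]_n) :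
    'M[{poly R}]_n :=
  'X^2 *: map_mx polyC M + 'X *: map_mx polyC D + map_mx polyC K.

(* The complex matrix L(z), for a real matrix polynomial L. *)
Definition mxpoly_eval (R : rcfType) (n : nat) (L : 'M[{poly R}]_n)
    (z : R[i]) : 'M[R[i]]_n :=
  map_mx (fun p : {poly R} => (map_poly (real_complex R) p).[z]) L.

Definition proper_value (R : rcfType) (n : nat) (L : 'M[{poly R}]_n)
    (z : R[i]) : Prop :=
  \det (mxpoly_eval L z) = 0.

(* Main.v *)
(* Pair the eigenvalues as mu_{i,0}, mu_{i,1} for i = 1..n and put e times the
   adjacency matrices of G and H off the diagonals of D and K. Write the i-th
   diagonal entry of L(z) as
     m_i (z - mu_{i,0}) (z - mu_{i,1}) + x_{i,0} (z - mu_{i,1})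
                                       + x_{i,1} (z - mu_{i,0}).
   Expanding along row i, det L(mu_{i,b}) = 0 becomes
     x_{i,b} (mu_{i,b} - mu_{i,1-b}) C_{ii} + e (...) = 0,
   where the cofactor C_{ii} is nonzero at x = 0, e = 0 because the mu are
   distinct. So x is a fixed point of e g(e, x) with g Lipschitz near 0, which
   exists by the contraction principle when e > 0 is small. The 2n zeros so
   prescribed exhaust those of det L, whose degree is 2n. *)
From HB Require Import structures.
Require Import Defs.
From mathcomp Require Import all_boot all_order all_fingroup all_algebra.
From mathcomp Require Import classical_sets functions reals complex.
From mathcomp Require Import interval_inference topology normedtype sequences.
From mathcomp Require Import lra ring.

Set Implicit Arguments.
Unset Strict Implicit.
Unset Printing Implicit Defensive.

Import Order.TTheory GRing.Theory Num.Theory.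
Import numFieldNormedType.Exports.
Local Open Scope ring_scope.

(** Registers matrices as a complete space, which the Banach fixed point theorem requires of row
    vectors. *)
HB.instance Definition _ (R : realType) m n := Complete.on 'M[R]_(m, n).

(** * Functions that are Lipschitz near 0 *)

Section LipschitzNear0.
Context {R : realType} {V : normedModType R}.
Implicit Types f g : V -> R.

(** The radius is existential so that products and inverses may shrink the ball. *)
Definition lip_near0 f := exists k r : R, [/\ 0 <= k, 0 < r &
  forall u v, `|u| <= r -> `|v| <= r -> `|f u - f v| <= k * `|u - v|].

Lemma eq_lip_near0 f g : f =1 g -> lip_near0 f -> lip_near0 g.
Proof.
move=> fg [k [r [k0 r0 fl]]]; exists k, r; split=> // u v ur vr.
by rewrite -!fg; exact: fl.
Qed.

Lemma lip_near0_cst c : lip_near0 (fun=> c).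
Proof. by exists 0, 1; split=> // u v _ _; rewrite subrr normr0 mul0r. Qed.

Lemma lip_near0_bounded f : lip_near0 f ->
  exists b r : R, [/\ 0 <= b, 0 < r & forall u, `|u| <= r -> `|f u| <= b].
Proof.
move=> [k [r [k0 r0 fl]]]; exists (`|f 0| + k * r), r; split=> // [|u ur].
  by rewrite addr_ge0// mulr_ge0// ltW.
rewrite -[f u](subrK (f 0)) addrC (le_trans (ler_normD _ _))// lerD2l.
have r0' : `|0 : V| <= r by rewrite normr0 ltW.
by rewrite (le_trans (fl _ _ ur r0'))// subr0 ler_wpM2l.
Qed.

Lemma lip_near0D f g :
  lip_near0 f -> lip_near0 g -> lip_near0 (fun v => f v + g v).
Proof.
move=> [k [r [k0 r0 fl]]] [k' [r' [k'0 r'0 gl]]].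
exists (k + k'), (Num.min r r'); split; rewrite ?addr_ge0 ?lt_min ?r0//.
move=> u v; rewrite !le_min => /andP[ur ur'] /andP[vr vr'].
rewrite opprD addrACA mulrDl (le_trans (ler_normD _ _))//.
by rewrite lerD ?fl ?gl.
Qed.

Lemma lip_near0M f g :
  lip_near0 f -> lip_near0 g -> lip_near0 (fun v => f v * g v).
Proof.
move=> lf lg.
have [b [s [b0 s0 fb]]] := lip_near0_bounded lf.
have [b' [s' [b'0 s'0 gb]]] := lip_near0_bounded lg.
move: lf lg => [k [r [k0 r0 fl]]] [k' [r' [k'0 r'0 gl]]].
exists (b * k' + b' * k), (Num.min (Num.min r r') (Num.min s s')).
split; rewrite ?addr_ge0 ?mulr_ge0 ?lt_min ?r0 ?r'0 ?s0//.
move=> u v; rewrite !le_min.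
move=> /andP[/andP[ur ur'] /andP[us us']] /andP[/andP[vr vr'] /andP[vs vs']].
have -> : f u * g u - f v * g v = f u * (g u - g v) + g v * (f u - f v) by ring.
rewrite (le_trans (ler_normD _ _))// !normrM mulrDl -!mulrA lerD//.
  by apply: ler_pM; rewrite ?normr_ge0 ?fb ?gl.
by apply: ler_pM; rewrite ?normr_ge0 ?gb ?fl.
Qed.

Lemma lip_near0_bounded_below f : f 0 != 0 -> lip_near0 f ->
  exists c r : R, [/\ 0 < c, 0 < r & forall u, `|u| <= r -> c <= `|f u|].
Proof.
move=> f0 [k [r [k0 r0 fl]]].
pose c := `|f 0| / 2; have c0 : 0 < c by rewrite divr_gt0 ?normr_gt0.
have kp : 0 < k + 1 by rewrite ltr_wpDl.
(* On this ball [f] moves by at most [c], half of |f(0)|. The divisor [k + 1] stays positive when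
   [k] is 0. *)
exists c, (Num.min r (c / (k + 1))); split=> // [|u].
  by rewrite lt_min r0 divr_gt0.
rewrite le_min ler_pdivlMr// => /andP[ur uc].
have r0' : `|0 : V| <= r by rewrite normr0 ltW.
have := fl _ _ ur r0'; rewrite subr0 => fu.
have kuc : k * `|u| <= c.
  by apply: le_trans uc; rewrite mulrC ler_wpM2l// lerDl.
have h : `|f 0| <= `|f u - f 0| + `|f u|.
  by rewrite -{1}[f 0](subrK (f u)) (le_trans (ler_normD _ _))// distrC.
have e : `|f 0| = c + c by rewrite /c; field.
lra.
Qed.

Lemma lip_near0_neq0 f : f 0 != 0 -> lip_near0 f ->
  exists2 r : R, 0 < r & forall u, `|u| <= r -> f u != 0.
Proof.
move=> f0 /(lip_near0_bounded_below f0)[c [r [c0 r0 fr]]].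
by exists r => // u /fr; rewrite -normr_gt0; exact: lt_le_trans.
Qed.

Lemma lip_near0V f : f 0 != 0 -> lip_near0 f -> lip_near0 (fun v => (f v)^-1).
Proof.
move=> f0 lf; have [c [s [c0 s0 fc]]] := lip_near0_bounded_below f0 lf.
have [t t0 fn0] := lip_near0_neq0 f0 lf.
have [k [r [k0 r0 fl]]] := lf.
(* The difference of inverses is (f(v) - f(u)) / (f(u) f(v)), whose denominator is at least c^2 in
   absolute value. *)
exists (k / c ^+ 2), (Num.min r (Num.min s t)); split.
- by rewrite divr_ge0// sqr_ge0.
- by rewrite !lt_min r0 s0.
move=> u v; rewrite !le_min => /and3P[ur us ut] /and3P[vr vs vt].
have -> : (f u)^-1 - (f v)^-1 = (f v - f u) / (f u * f v).
  by field; rewrite !fn0.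
rewrite normrM normfV normrM mulrAC ler_pM ?invr_ge0 ?mulr_ge0//.
  by rewrite distrC fl.
rewrite lef_pV2 ?posrE ?mulr_gt0 ?exprn_gt0 ?normr_gt0 ?fn0//.
by rewrite expr2 ler_pM ?fc// ltW.
Qed.

Lemma lip_near0_sum (I : Type) (s : seq I) (P : pred I) (F : I -> V -> R) :
  (forall i, P i -> lip_near0 (F i)) ->
  lip_near0 (fun v => \sum_(i <- s | P i) F i v).
Proof.
move=> FL; elim: s => [|i s ih].
  by apply: (eq_lip_near0 _ (lip_near0_cst 0)) => v; rewrite big_nil.
have [Pi|Pi] := boolP (P i).
  apply: (eq_lip_near0 _ (lip_near0D (FL i Pi) ih)) => v.
  by rewrite big_cons Pi.
by apply: (eq_lip_near0 _ ih) => v; rewrite big_cons (negPf Pi).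
Qed.

Lemma lip_near0_prod (I : Type) (s : seq I) (F : I -> V -> R) :
  (forall i, lip_near0 (F i)) -> lip_near0 (fun v => \prod_(i <- s) F i v).
Proof.
move=> FL; elim: s => [|i s ih].
  by apply: (eq_lip_near0 _ (lip_near0_cst 1)) => v; rewrite big_nil.
by apply: (eq_lip_near0 _ (lip_near0M (FL i) ih)) => v; rewrite big_cons.
Qed.

(** By the Leibniz formula the determinant is a finite sum of products of entries. *)
Lemma lip_near0_det n (A : V -> 'M[R]_n) :
  (forall i j, lip_near0 (fun v => A v i j)) -> lip_near0 (fun v => \det (A v)).
Proof.
move=> AL; apply: lip_near0_sum => s _.
by apply: lip_near0M; [exact: lip_near0_cst|exact: lip_near0_prod].
Qed.

Lemma lip_near0_cofactor n (A : V -> 'M[R]_n) i j :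
  (forall i j, lip_near0 (fun v => A v i j)) ->
  lip_near0 (fun v => cofactor (A v) i j).
Proof.
move=> AL; apply: lip_near0M; first exact: lip_near0_cst.
by apply: lip_near0_det => k l; apply: eq_lip_near0 (AL _ _) => v; rewrite !mxE.
Qed.

(** A single constant, serving as both bound and Lipschitz constant, controls all coordinates of a
    vector-valued map in the sup norm. *)
Lemma lip_near0_uniform (I : finType) (F : I -> V -> R) :
  (forall i, lip_near0 (F i)) ->
  exists b r : R, [/\ 0 <= b, 0 < r & forall i u v, `|u| <= r -> `|v| <= r ->
    `|F i u| <= b /\ `|F i u - F i v| <= b * `|u - v|].
Proof.
move=> FL.
suff [b [r [b0 r0 h]]] : exists b r : R, [/\ 0 <= b, 0 < r &
    forall i, i \in enum I -> forall u v, `|u| <= r -> `|v| <= r ->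
    `|F i u| <= b /\ `|F i u - F i v| <= b * `|u - v|].
  by exists b, r; split=> // i; apply: h; rewrite mem_enum.
elim: (enum I) => [|i s [b [r [b0 r0 h]]]]; first by exists 0, 1; split.
have [b' [r' [b'0 r'0 h']]] := lip_near0_bounded (FL i).
have [k [t [k0 t0 fl]]] := FL i.
exists (b + b' + k), (Num.min r (Num.min r' t)).
split; rewrite ?addr_ge0 ?lt_min ?r0 ?r'0//.
move=> j js u v; rewrite !le_min => /and3P[ur ur' ut] /and3P[vr vr' vt].
move: js; rewrite inE => /predU1P[->|js].
  split; first by apply: le_trans (h' _ ur') _; lra.
  by apply: le_trans (fl _ _ ut vt) _; rewrite ler_wpM2r//; lra.
have [hu hd] := h _ js _ _ ur vr.
split; first by apply: le_trans hu _; lra.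
by apply: le_trans hd _; rewrite ler_wpM2r//; lra.
Qed.

End LipschitzNear0.

(** * Sup norms on matrices and pairs, and the contraction principle *)

Lemma mx_norm_leP (R : realType) m n (A : 'M[R]_(m, n)) (c : R) : 0 <= c ->
  `|A| <= c <-> (forall i j, `|A i j| <= c).
Proof.
move=> c0; rewrite [`|A|]mx_normrE; split=> [h i j|h].
  by apply: le_trans h; apply: (le_bigmax _ (fun ij => `|A ij.1 ij.2|) (i, j)).
by apply: bigmax_le => // -[i j] _ /=; exact: h.
Qed.

Lemma lip_near0_fst (R : realType) (V W : normedModType R) (f : V -> R) :
  lip_near0 f -> lip_near0 (fun p : V * W => f p.1).
Proof.
move=> [k [r [k0 r0 fl]]]; exists k, r; split=> // u v.
rewrite [`|u|]/Num.norm [`|v|]/Num.norm/= !ge_max => /andP[ur _] /andP[vr _].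
rewrite (le_trans (fl _ _ ur vr))// ler_wpM2l//.
by rewrite [leRHS]/Num.norm/= le_max lexx.
Qed.

Lemma lip_near0_snd (R : realType) (V W : normedModType R) (f : W -> R) :
  lip_near0 f -> lip_near0 (fun p : V * W => f p.2).
Proof.
move=> [k [r [k0 r0 fl]]]; exists k, r; split=> // u v.
rewrite [`|u|]/Num.norm [`|v|]/Num.norm/= !ge_max => /andP[_ ur] /andP[_ vr].
rewrite (le_trans (fl _ _ ur vr))// ler_wpM2l//.
by rewrite [leRHS]/Num.norm/= le_max lexx orbT.
Qed.

Lemma lip_near0_id (R : realType) : lip_near0 (@id R^o).
Proof. by exists 1, 1; split=> // u v _ _; rewrite mul1r. Qed.

Lemma lip_near0_coord (R : realType) m n i j :
  lip_near0 (fun A : 'M[R]_(m, n) => A i j).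
Proof.
exists 1, 1; split=> // u v _ _; rewrite mul1r.
have /mx_norm_leP := lexx `|u - v|.
by move=> /(_ (normr_ge0 _) i j); rewrite !mxE.
Qed.

(* Named so that the norm of an explicit pair (e, x) can be inferred. *)
Definition pert_space (R : realType) N : normedModType R :=
  (R^o * 'rV[R]_N)%type.

(** For fixed e, the map x -> e g(e, x) is bounded by e b and has Lipschitz constant e b on a small
    ball, so a small e makes it a contraction of that ball into itself. *)
Lemma small_fixed_point (R : realType) (N : nat)
    (g : 'I_N -> pert_space R N -> R) (s : R) :
  0 < s -> (forall k, lip_near0 (g k)) ->
  exists (e : R) (x : 'rV[R]_N), [/\ 0 < e, `|(e, x) : pert_space R N| <= s &
    forall k, x 0 k = e * g k (e, x)].
Proof.
move=> s0 /lip_near0_uniform[b [r' [b0 r'0 gl]]].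
pose r := Num.min r' s; have r0 : 0 < r by rewrite lt_min r'0.
pose c := Num.min 1 r; have c0 : 0 < c by rewrite lt_min ltr01.
have cr : c <= r by rewrite ge_min lexx orbT.
have b1 : 0 < b + 1 by rewrite ltr_wpDl.
(* This choice gives e b < c: [c <= r] keeps the ball invariant, [c <= 1] yields a contraction. Also
   e <= r, so the pairs (e, x) stay where the estimates hold. *)
have [e [e0 eb]] : exists e : R, 0 < e /\ e * (b + 1) = c.
  by exists (c / (b + 1)); rewrite divr_gt0// divfK// gt_eqF.
have er : e <= r.
  by apply: le_trans cr; rewrite -eb ler_peMr ?lerDr// ltW.
have ebc : e * b <= c by rewrite -eb ler_wpM2l ?lerDl// ltW.
have eb1 : e * b < 1.
  by rewrite (@lt_le_trans _ _ c) ?ge_min ?lexx// -eb ltr_pM2l// ltrDl.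
have pr (x : 'rV[R]_N) : `|x| <= r -> `|(e, x) : pert_space R N| <= r.
  by move=> xr; rewrite /Num.norm/= ge_max xr andbT ger0_norm// ltW.
have rr' : r <= r' by rewrite ge_min lexx.
pose U : set 'rV[R]_N := closed_ball_ Num.norm 0 r.
have Ur x : U x -> `|x| <= r by rewrite /U /closed_ball_/= sub0r normrN.
pose T (x : 'rV[R]_N) : 'rV[R]_N := \row_k (e * g k (e, x)).
have TU : set_fun U U T.
  move=> x /Ur xr; rewrite /U /closed_ball_/= sub0r normrN.
  apply/mx_norm_leP => [|i k]; first exact: ltW.
  rewrite mxE normrM gtr0_norm// (le_trans _ (le_trans ebc cr))// ler_pM2l//.
  have xr' := le_trans (pr _ xr) rr'.
  by have [] := gl k _ _ xr' xr'.
pose q : {nonneg R} := NngNum (mulr_ge0 (ltW e0) b0).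
have ctr : is_contraction (mkfun TU).
  exists q; split=> //= -[x y] [/Ur xr /Ur yr] /=.
  apply/mx_norm_leP => [|i k].
    by apply: mulr_ge0 => //; exact: (mulr_ge0 (ltW e0)).
  rewrite !mxE -mulrBr normrM gtr0_norm// -mulrA ler_pM2l//.
  have [_] := gl k _ _ (le_trans (pr _ xr) rr') (le_trans (pr _ yr) rr').
  move=> /le_trans; apply; rewrite ler_wpM2l//.
  (* The first components cancel, so the distance between the pairs is that between x and y. *)
  have -> : ((e, x) : pert_space R N) - (e, y) = (0, x - y).
    by congr pair; exact: subrr.
  by rewrite [leLHS]/Num.norm/= ge_max normr0 normr_ge0 lexx.
have clU : closed U by exact: closed_closed_ball_.
have [|x /Ur xr xT] := banach_fixed_point ctr clU.
  by exists 0; rewrite /U /closed_ball_/= subrr normr0 ltW.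
exists e, x; split=> //.
  by apply: le_trans (pr _ xr) _; rewrite ge_min lexx orbT.
by move=> k; rewrite {1}xT mxE.
Qed.

(** * Degree of the determinant and its zeros *)

(** In the convolution, an index below [a] asks for a coefficient of [q] beyond [b], and an index
    above [a] for one of [p] beyond [a]. Both bounds may exceed the actual degrees. *)
Lemma coefM_top (R : nzRingType) (p q : {poly R}) a b :
  (size p <= a.+1)%N -> (size q <= b.+1)%N -> (p * q)`_(a + b) = p`_a * q`_b.
Proof.
move=> pa qb; have lta : (a < (a + b).+1)%N by rewrite ltnS leq_addr.
rewrite coefM (bigD1 (Ordinal lta))//= addKn big1 ?addr0// => i ia.
have : (i != a :> nat) by [].
rewrite neq_ltn => /orP[ilt|agt].
  by rewrite [q`__]nth_default ?mulr0// (leq_trans qb)// ltn_subRL ltn_add2r.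
by rewrite [p`__]nth_default ?mul0r// (leq_trans pa).
Qed.

Lemma size_coef_prod_top (R : comNzRingType) n d (F : 'I_n -> {poly R}) :
  (forall i, (size (F i) <= d.+1)%N) ->
  (size (\prod_i F i)%R <= (n * d).+1)%N /\
  (\prod_i F i)`_(n * d) = \prod_i (F i)`_d.
Proof.
elim: n F => [F _|n ih F sF]; first by rewrite !big_ord0 size_poly1 coef1.
have [s c] := ih (fun i => F (lift ord0 i)) (fun i => sF _).
rewrite !big_ord_recl mulSn; split; last by rewrite coefM_top// c.
rewrite (leq_trans (size_polyMleq _ _))// -subn1 leq_subLR.
by rewrite add1n -addSn -addnS leq_add.
Qed.

(** Each Leibniz product has degree at most n d, and its coefficient there is the product of the
    degree-d coefficients of its factors. For L(z) this makes det M the coefficient of z^(2n). *)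
Lemma size_coef_det_top (R : comNzRingType) n d (A : 'M[{poly R}]_n) :
  (forall i j, (size (A i j) <= d.+1)%N) ->
  (size (\det A) <= (n * d).+1)%N /\
  (\det A)`_(n * d) = \det (map_mx (coefp d) A).
Proof.
move=> sA; have h (s : 'S_n) := size_coef_prod_top (fun i => sA i (s i)).
split.
  rewrite (leq_trans (size_sum _ _ _))//; apply/bigmax_leqP => s _.
  by rewrite size_Msign; have [] := h s.
rewrite coef_sum; apply: eq_bigr => s _.
have -> : \prod_i map_mx (coefp d) A i (s i) = \prod_i (A i (s i))`_d.
  by apply: eq_bigr => i _; rewrite !mxE.
by rewrite -(h s).2 !mulr_sign; case: ifP; rewrite ?coefN.
Qed.

Lemma horner_det (R : comNzRingType) n (A : 'M[{poly R}]_n) (z : R) :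
  (\det A).[z] = \det (map_mx (horner^~ z) A).
Proof. by rewrite -[LHS]/(horner_eval z (\det A)) -det_map_mx. Qed.

Lemma size_quadratic_mxpoly (R : nzRingType) n (M D K : 'M[R]_n) i j :
  (size (quadratic_mxpoly M D K i j) <= 3)%N.
Proof.
apply/leq_sizeP => k k3; rewrite !mxE !coefD coefXnM coefXM !coefC.
by case: k k3 => [|[|[|k]]]//= _; rewrite !addr0.
Qed.

Lemma coef2_quadratic_mxpoly (R : nzRingType) n (M D K : 'M[R]_n) :
  map_mx (coefp 2) (quadratic_mxpoly M D K) = M.
Proof.
apply/matrixP => i j; rewrite !mxE /= !coefD coefXnM coefXM !coefC/=.
by rewrite !addr0.
Qed.

(** The quadratic form at the i-th basis vector is the i-th diagonal entry. *)
Lemma posdef_diag_gt0 (R : realFieldType) n (M : 'M[R]_n) i :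
  posdefmx M -> 0 < M i i.
Proof.
move=> [_ /(_ (delta_mx i 0))]; rewrite trmx_delta -rowE -colE !mxE; apply.
by apply/eqP => /matrixP/(_ i 0); rewrite !mxE !eqxx => /eqP; rewrite oner_eq0.
Qed.

(** Embedding coefficients and evaluating are ring morphisms, hence commute with the determinant. *)
Lemma proper_value_det (R : rcfType) n (L : 'M[{poly R}]_n) (z : R[i]) :
  proper_value L z <-> root (map_poly (real_complex R) (\det L)) z.
Proof.
rewrite /proper_value /root; suff -> : \det (mxpoly_eval L z) =
  (map_poly (real_complex R) (\det L)).[z] by split=> /eqP.
rewrite -det_map_mx horner_det; congr (\det _).
by apply/matrixP => i j; rewrite !mxE.
Qed.

(** As det M is nonzero, det L has degree exactly 2n; its 2n distinct real roots split it over R,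
    which leaves no other complex zero. *)
Lemma all_proper_values (R : rcfType) n (M D K : 'M[R]_n)
    (lambda : 'I_(2 * n) -> R) : injective lambda -> \det M != 0 ->
  (forall k, (\det (quadratic_mxpoly M D K)).[lambda k] = 0) ->
  forall z : R[i], proper_value (quadratic_mxpoly M D K) z <->
    exists k : 'I_(2 * n), z = real_complex R (lambda k).
Proof.
move=> linj detM lroot z; rewrite proper_value_det.
have := size_coef_det_top (size_quadratic_mxpoly M D K).
rewrite coef2_quadratic_mxpoly; set p := \det _ in lroot * => -[sp cp].
pose rs := [seq lambda k | k <- enum 'I_(2 * n)].
have sp' : size p = (size rs).+1.
  apply/eqP; rewrite size_map size_enum_ord eqn_leq mulnC sp ltnNge /=.
  by apply: contraNN detM => spn; rewrite -cp nth_default.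
have rsP : all (root p) rs by apply/allP => _ /mapP[k _ ->]; apply/eqP.
have rsu : uniq_roots rs by rewrite uniq_rootsE map_inj_uniq ?enum_uniq.
have p0 : lead_coef p != 0 by rewrite lead_coef_eq0 -size_poly_gt0 sp'.
rewrite (all_roots_prod_XsubC sp' rsP rsu) map_polyZ rootZ ?fmorph_eq0//.
rewrite map_prod_XsubC -(big_map (real_complex R) xpredT (fun a => 'X - a%:P)).
rewrite root_prod_XsubC; split=> [/mapP[_ /mapP[k _ ->] ->]|[k ->]].
  by exists k.
by rewrite !map_f// mem_enum.
Qed.

(** * The perturbed matrix polynomial *)

(** A nonidentity permutation fixing i moves some other index, and so contributes a zero
    off-diagonal entry. *)
Lemma cofactor_diag (R : comNzRingType) n (A : 'M[R]_n) i :
  (forall k l, k != l -> A k l = 0) ->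
  cofactor A i i = \prod_(k | k != i) A k k.
Proof.
move=> Adiag; rewrite expand_cofactor (bigD1 1%g)/=; last by rewrite perm1.
rewrite odd_perm1 mul1r [X in _ + X]big1 ?addr0 => [|s /andP[/eqP si s1]].
  by apply: eq_big => [k|k _]; rewrite ?perm1// eq_sym.
suff [k ik sk] : exists2 k, i != k & s k != k.
  by rewrite (bigD1 k)//= Adiag ?mul0r ?mulr0// eq_sym.
apply/exists_inP; apply: contraNT s1 => /exists_inPn h.
apply/eqP/permP => k; rewrite perm1; have [<-//|ik] := eqVneq i k.
by have := h k ik; rewrite negbK => /eqP.
Qed.

Section Perturbation.
Context {R : realType} {n N : nat}.
Variables (G H : rel 'I_n) (m : 'I_n -> R) (lambda : 'I_N -> R).
(** The bijection [f], with inverse [h], assigns two eigenvalues to each row. *)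
Variables (f : 'I_n * bool -> 'I_N) (h : 'I_N -> 'I_n * bool).
Hypotheses (fK : cancel f h) (hK : cancel h f).
Hypotheses (m_gt0 : forall i, 0 < m i) (lambda_inj : injective lambda).

Local Notation mu i b := (lambda (f (i, b))).

(** Here p = (e, x). The diagonals of [pertD] and [pertK] hold the coefficients of z and of 1 in m_i
    (z - mu_{i,0}) (z - mu_{i,1}) + x_{i,0} (z - mu_{i,1}) + x_{i,1} (z - mu_{i,0}). *)
Definition pertD (p : pert_space R N) : 'M[R]_n := \matrix_(i, j)
  if i == j then p.2 0 (f (i, false)) + p.2 0 (f (i, true))
                 - m i * (mu i false + mu i true)
  else p.1 * (G i j)%:R.

Definition pertK (p : pert_space R N) : 'M[R]_n := \matrix_(i, j)
  if i == j then m i * (mu i false * mu i true)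
                 - p.2 0 (f (i, false)) * mu i true
                 - p.2 0 (f (i, true)) * mu i false
  else p.1 * (H i j)%:R.

Definition pertL (z : R) (p : pert_space R N) : 'M[R]_n := \matrix_(i, j)
  ((m i *+ (i == j)) * z ^+ 2 + pertD p i j * z + pertK p i j).

Lemma mu_neq i j b c : (i, b) != (j, c) -> mu i b - mu j c != 0.
Proof.
by move=> ne; rewrite subr_eq0 (inj_eq lambda_inj) (inj_eq (can_inj fK)).
Qed.

(** At z = mu_{i,b} every term but that of x_{i,b} vanishes, so each equation can be solved for its
    own unknown. *)
Lemma pertL_diag i b p :
  pertL (mu i b) p i i = p.2 0 (f (i, b)) * (mu i b - mu i (~~ b)).
Proof. by rewrite !mxE eqxx mulr1n; case: b => /=; ring. Qed.

Lemma pertL_offdiag z p i j : i != j ->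
  pertL z p i j = p.1 * ((G i j)%:R * z + (H i j)%:R).
Proof. by move=> ij; rewrite !mxE (negPf ij) mulr0n; ring. Qed.

Lemma pertL0_cofactor_neq0 i b : cofactor (pertL (mu i b) 0) i i != 0.
Proof.
rewrite cofactor_diag => [|k l kl]; last by rewrite pertL_offdiag// mul0r.
apply/prodf_neq0 => k ki; rewrite !mxE eqxx mulr1n /=.
set z := mu i b.
have -> : m k * z ^+ 2 + (0 + 0 - m k * (mu k false + mu k true)) * z +
  (m k * (mu k false * mu k true) - 0 * mu k true - 0 * mu k false) =
  m k * ((z - mu k false) * (z - mu k true)) by ring.
have ne c : z - mu k c != 0.
  by apply: mu_neq; rewrite xpair_eqE eq_sym (negPf ki).
by rewrite !mulf_neq0 ?ne// lt0r_neq0.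
Qed.

(** For fixed z every entry is affine in (e, x). *)
Lemma lip_near0_pertL z i j : lip_near0 (fun p => pertL z p i j).
Proof.
have lx k : lip_near0 (fun p : pert_space R N => p.2 0 k).
  exact: (lip_near0_snd R^o (lip_near0_coord R 0 k)).
have le : lip_near0 (fun p : pert_space R N => p.1).
  exact: (lip_near0_fst 'rV[R]_N (lip_near0_id R)).
have lc := @lip_near0_cst R (pert_space R N).
have [<-|ij] := eqVneq i j.
  apply: (@eq_lip_near0 _ _ (fun p : pert_space R N =>
    p.2 0 (f (i, false)) * (z - mu i true)
    + p.2 0 (f (i, true)) * (z - mu i false)
    + m i * ((z - mu i false) * (z - mu i true)))) => [p|].
    by rewrite !mxE eqxx mulr1n; ring.
  by do !apply: lip_near0D => //; apply: lip_near0M.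
apply: (eq_lip_near0 (fun p => esym (pertL_offdiag z p ij))).
exact: lip_near0M.
Qed.

Lemma exists_perturbation : exists p : pert_space R N,
  0 < p.1 /\ forall k, \det (pertL (lambda k) p) = 0.
Proof.
pose cof k p j := cofactor (pertL (lambda k) p) (h k).1 j.
have lcof k j : lip_near0 (fun p => cof k p j).
  by apply: lip_near0_cofactor => ? ?; exact: lip_near0_pertL.
have cof0 k : cof k 0 (h k).1 != 0.
  by rewrite /cof -{1}[k]hK; case: (h k) => i b; exact: pertL0_cofactor_neq0.
have [s s0 cofs] : exists2 s : R, 0 < s &
    forall p : pert_space R N, `|p| <= s -> forall k, cof k p (h k).1 != 0.
  (* Applying the lemma to the product of all cofactors gives one radius for all k. *)
  have [|s s0 cofs] := @lip_near0_neq0 _ _ (fun p => \prod_k cof k p (h k).1)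
    _ (lip_near0_prod _ (fun k => lcof k _)).
    exact/prodf_neq0.
  by exists s => // p /cofs/prodf_neq0 + k => /(_ k); exact.
(* The gap between an eigenvalue and its partner in the same row. *)
pose d k := lambda k - mu (h k).1 (~~ (h k).2).
have d0 k : d k != 0.
  rewrite /d -{1}[k]hK; case: (h k) => i b; apply: mu_neq.
  by rewrite xpair_eqE eqxx; case: b.
pose S k p := \sum_(j | j != (h k).1)
  ((G (h k).1 j)%:R * lambda k + (H (h k).1 j)%:R) * cof k p j.
(* Expansion along row [(h k).1] gives x_k d_k C_k + e S_k = 0, with C_k the diagonal cofactor;
   solved for x_k it reads x_k = e g_k. *)
pose g k p := - S k p / (d k * cof k p (h k).1).
have lg k : lip_near0 (g k).
  have lc := @lip_near0_cst R (pert_space R N).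
  apply: (@eq_lip_near0 _ _
    (fun p => (- (d k)^-1) * S k p * (cof k p (h k).1)^-1)).
    by move=> p; rewrite /g (invfM (d k)) !mulNr (mulrC (d k)^-1) mulrA.
  apply: lip_near0M; last exact: lip_near0V.
  by apply: lip_near0M => //; apply: lip_near0_sum => j _; exact: lip_near0M.
have [e [x [e0 exs xg]]] := small_fixed_point s0 lg.
exists (e, x); split=> // k.
rewrite (expand_det_row _ (h k).1) (bigD1 (h k).1)//=.
have -> : pertL (lambda k) (e, x) (h k).1 (h k).1 = x 0 k * d k.
  have hk : f ((h k).1, (h k).2) = k by rewrite -surjective_pairing hK.
  by have := pertL_diag (h k).1 (h k).2 (e, x); rewrite hk.
have -> : \sum_(j | j != (h k).1) pertL (lambda k) (e, x) (h k).1 j *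
    cofactor (pertL (lambda k) (e, x)) (h k).1 j = e * S k (e, x).
  rewrite mulr_sumr; apply: eq_bigr => j ji.
  by rewrite pertL_offdiag ?mulrA// eq_sym.
rewrite xg /g -/(cof k (e, x) (h k).1).
field.
by rewrite d0 cofs.
Qed.

End Perturbation.

(** * Symmetry, graphs and the conclusion *)

Lemma symmetricmxI (R : fieldType) n (A : 'M[R]_n) :
  (forall i j, A i j = A j i) -> A \is symmetricmx.
Proof.
move=> Asym; apply/is_hermitianmxP; apply/matrixP => i j.
by rewrite expr0 scale1r !mxE.
Qed.

Theorem corollary5p3 (R : realType) (n : nat) (n_ge1 : (1 <= n)%N)
    (G H : rel 'I_n) (G_simple : simple_graph G) (H_simple : simple_graph H)
    (M : 'M[R]_n) (M_diag : is_diag_mx M) (M_posdef : posdefmx M)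
    (lambda : 'I_(2 * n) -> R) (lambda_inj : injective lambda) :
  exists D K : 'M[R]_n,
    [/\ D \is symmetricmx, K \is symmetricmx,
        mx_graph D =2 G, mx_graph K =2 H
      & forall z : R[i],
          proper_value (quadratic_mxpoly M D K) z <->
          exists k : 'I_(2 * n), z = real_complex R (lambda k)].
Proof.
have cardf : #|{: 'I_n * bool}| = (2 * n)%N.
  by rewrite card_prod card_ord card_bool mulnC.
(* Any pairing of the eigenvalues works; this one comes from the enumeration of the pairs. *)
pose f p : 'I_(2 * n) := cast_ord cardf (enum_rank p).
pose h k : 'I_n * bool := enum_val (cast_ord (esym cardf) k).
have fK : cancel f h by move=> p; rewrite /h /f cast_ordK enum_rankK.
have hK : cancel h f by move=> k; rewrite /h /f enum_valK cast_ordKV.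
pose m i := M i i.
have m0 i : 0 < m i by exact: posdef_diag_gt0.
have ME i j : M i j = m i *+ (i == j).
  by have [<-//|ij] := eqVneq i j; move/is_diag_mxP: M_diag; apply.
have [p [p0 pL]] := exists_perturbation G H fK hK m0 lambda_inj.
(* Since e > 0, the off-diagonal entries are nonzero exactly on the edges. *)
have off (E : rel 'I_n) i j : (p.1 * (E i j)%:R != 0) = E i j.
  by rewrite mulf_eq0 gt_eqF//=; case: (E i j); rewrite ?oner_eq0 ?eqxx.
have [[Gsym Girr] [Hsym Hirr]] := (G_simple, H_simple).
exists (pertD G m lambda f p), (pertK H m lambda f p); split.
- apply: symmetricmxI => i j; rewrite !mxE eq_sym Gsym.
  by case: eqVneq => // ->.
- apply: symmetricmxI => i j; rewrite !mxE eq_sym Hsym.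
  by case: eqVneq => // ->.
- move=> i j; rewrite /mx_graph mxE; have [<-|_] := eqVneq i j; last exact: off.
  by rewrite Girr.
- move=> i j; rewrite /mx_graph mxE; have [<-|_] := eqVneq i j; last exact: off.
  by rewrite Hirr.
apply: all_proper_values => // [|k].
  have -> : M = diag_mx (\row_i m i) by apply/matrixP => i j; rewrite ME !mxE.
  by rewrite det_diag; apply/prodf_neq0 => i _; rewrite mxE lt0r_neq0.
rewrite horner_det -[RHS](pL k); congr (\det _); apply/matrixP => i j.
by rewrite !mxE -ME !(hornerD, hornerM, hornerXn, hornerX, hornerC); ring.
Qed.
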